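(* Let $k$ be a field (of arbitrary characteristic), $R=k[x_1,\dots,x_n]$, and let $f\in R$ be a polynomial of degree $d$. Then the length of $R_f$ in the category of $D(R,k)$-modules is at most $(d+1)^n$, and the length of $H^1_f(R)$ in the category of $D(R,k)$-modules is at most $(d+1)^n-1$.
   Context: $D(R,k)$ denotes the ring of $k$-linear differential operators on $R$; it is generated over $R$ by the operators $\frac{1}{t!}\frac{\partial^t}{\partial x_i^t}$, $t\ge 0$, $1\le i\le n$. $R_f$ and $H^1_f(R)=R_f/R$ carry natural $D(R,k)$-module structures. *)

(* Defs.v *)
From HB Require Import structures.
From mathcomp Require Import all_boot all_order all_algebra.
From mathcomp Require Import fraction.
From mathcomp Require Import mpoly.
Set Implicit Arguments. Unset Strict Implicit. Unset Printing Implicit Defensive.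
Import GRing.Theory.
Local Open Scope ring_scope.
Notation "x %:F" := (@FracField.tofrac _ x) : ring_scope.

(* R = k[x_1..x_n] is {mpoly k[n]}; we work inside its fraction field
   K = {fraction {mpoly k[n]}}, in which R_f = { g / f^m } lives. *)

Definition taylor (k : fieldType) (n : nat) (i : 'I_n) (g : {mpoly k[n]})
  : {poly {fraction {mpoly k[n]}}} :=
  mmap (fun c : k => ((c%:MP : {mpoly k[n]})%:F)%:P)
       (fun j : 'I_n => ((('X_j : {mpoly k[n]})%:F)%:P + (j == i)%:R * 'X)) g.

(* Action of the divided-power operator D_i^(t) = (1/t!) d^t/dx_i^t on the
   fraction g/b (b <> 0): the coefficient of T^t in
   theta(g/b) = theta(g) * theta(b)^{-1}, where
   theta(b)^{-1} = sum_{j>=0} (b - theta(b))^j / b^(j+1) (only j <= t matter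
   for the coefficient of T^t).  For b = 1 this is the Hasse derivative on R. *)
Definition hasse_frac (k : fieldType) (n : nat) (i : 'I_n) (t : nat)
  (g b : {mpoly k[n]}) : {fraction {mpoly k[n]}} :=
  (taylor i g *
   \sum_(j < t.+1) ((b%:F)%:P - taylor i b) ^+ j * ((b%:F) ^- j.+1)%:P)`_t.

Definition in_loc (k : fieldType) (n : nat) (f : {mpoly k[n]})
  (q : {fraction {mpoly k[n]}}) : Prop :=
  exists (g : {mpoly k[n]}) (m : nat), q = g%:F / (f%:F) ^+ m.

(* N is a D(R,k)-submodule of R_f: an R-submodule stable under the generators
   D_i^(t) of D(R,k) over R. *)
Definition Dsubmod (k : fieldType) (n : nat) (f : {mpoly k[n]})
  (N : {fraction {mpoly k[n]}} -> Prop) : Prop :=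
  [/\ (forall q, N q -> in_loc f q),
      N 0,
      (forall q1 q2, N q1 -> N q2 -> N (q1 + q2)),
      (forall (r : {mpoly k[n]}) q, N q -> N (r%:F * q)) &
      (forall (i : 'I_n) (t : nat) (g : {mpoly k[n]}) (m : nat),
         N (g%:F / (f%:F) ^+ m) -> N (hasse_frac i t g (f ^+ m)))].

Definition sstrict (T : Type) (A B : T -> Prop) : Prop :=
  (forall x, A x -> B x) /\ exists x, B x /\ ~ A x.

Definition length_Rf_le (k : fieldType) (n : nat) (f : {mpoly k[n]}) (L : nat)
  : Prop :=
  forall (C : nat -> {fraction {mpoly k[n]}} -> Prop) (l : nat),
    (forall j, (j <= l)%N -> Dsubmod f (C j)) ->
    (forall j, (j < l)%N -> sstrict (C j) (C j.+1)) ->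
    (l <= L)%N.

(* length of H^1_f(R) = R_f / R as a D(R,k)-module is <= L.  D-submodules of
   R_f/R are identified with their preimages in R_f, i.e. with the
   D-submodules of R_f containing R (correspondence theorem). *)
Definition length_H1f_le (k : fieldType) (n : nat) (f : {mpoly k[n]}) (L : nat)
  : Prop :=
  forall (C : nat -> {fraction {mpoly k[n]}} -> Prop) (l : nat),
    (forall j, (j <= l)%N ->
       Dsubmod f (C j) /\ forall r : {mpoly k[n]}, C j (r%:F)) ->
    (forall j, (j < l)%N -> sstrict (C j) (C j.+1)) ->
    (l <= L)%N.

(* Main.v *)
Require Import Defs.
From HB Require Import structures.
From Stdlib Require Import Classical_Prop.
From mathcomp Require Import all_boot all_order all_algebra.
From mathcomp Require Import fraction.
From mathcomp Require Import mpoly.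
From mathcomp Require Import zify ring.
Set Implicit Arguments. Unset Strict Implicit. Unset Printing Implicit Defensive.
Import GRing.Theory.
Local Open Scope ring_scope.

(** Filter R_f by the subspaces G_s = { g / f^s : deg g <= (d+1) s }.  A variable
    maps G_s to G_(s+1) and a divided power of order t maps G_s to G_(s+t), while
    dim G_s <= C(n + (d+1) s, n), which grows like (d+1)^n s^n / n!.

    Every nonzero D-module contains a family (e_b), b in N^n, that is linearly
    independent over k and such that e_b is obtained from e_0 by operators of total
    weight |b|.  The factors of a chain of length l therefore give
    l C(n + i, n) <= dim G_(s+i) for some s and all i, whence l <= (d+1)^n.

    To build the family, treat the variables x_1, ..., x_n one after the other.  Let
    M be the current module, N the zero class, and B a space of polynomials in the
    variables already treated whose nonzero elements act injectively on M / N.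
    - If all nonzero G in B[x_j] act injectively, use the powers of x_j.
    - Otherwise take a nonzero G in B[x_j] of least degree killing a nonzero element,
      and let q >= 1 be least such that the q-th Hasse derivative G^[q] in x_j is not
      0.  On elements killed by G one has G^m D_j^(qm) = (-G^[q])^m and
      G^m D_j^(b) = 0 for b < qm, and by minimality G^[q] and the nonzero polynomials
      of x_j-degree < q act injectively.  So one uses x_j^a D_j^(qm) with a < q, one
      operator for each weight a + qm; M shrinks to the elements killed by G.
    The role of q makes the argument independent of the characteristic.

    A chain of submodules containing R can be extended below by 0, which gives the
    bound for R_f / R. *)

(** * Power series modulo a power of the variable *)

Definition eqmodX (A : nzRingType) (N : nat) (P Q : {poly A}) :=
  forall t, (t < N)%N -> P`_t = Q`_t.

Lemma eqmodX_mull (A : nzRingType) N (S P Q : {poly A}) :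
  eqmodX N P Q -> eqmodX N (S * P) (S * Q).
Proof.
move=> ePQ t lttN; rewrite !coefM; apply: eq_bigr => j _.
by rewrite ePQ // (leq_ltn_trans _ lttN) // leq_subr.
Qed.

(** A series with nonzero constant term is invertible modulo any power of the variable; the
    coefficients agree one after the other. *)
Lemma eqmodX_cancel (F : fieldType) N (S P Q : {poly F}) :
  S`_0 != 0 -> eqmodX N (S * P) (S * Q) -> eqmodX N P Q.
Proof.
move=> S0 eSPQ t; have [m] := ubnP t; elim: m t => // m IH t letm lttN.
have := eSPQ t lttN; rewrite !coefM !big_ord_recl !subn0 /=.
rewrite (eq_bigr (fun j : 'I_t => S`_j.+1 * Q`_(t - j.+1))); last first.
  by move=> j _; have ltjt := ltn_ord j; rewrite /bump leq0n add1n IH //; lia.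
by move/addIr/(mulfI S0).
Qed.

(** Read [P] as the truncated expansion of [g / b]: it depends on the fraction only. *)
Lemma eqmodX_cross (A : comNzRingType) (F : fieldType)
    (T : {rmorphism A -> {poly F}}) N (b b' g g' : A) (P : {poly F}) :
  (T b)`_0 != 0 -> g * b' = g' * b ->
  eqmodX N (T b * P) (T g) -> eqmodX N (T b' * P) (T g').
Proof.
move=> b0 gb bP; apply: (eqmodX_cancel b0) => t lttN.
by rewrite mulrCA (eqmodX_mull (T b') bP lttN) mulrC -rmorphM gb rmorphM mulrC.
Qed.

Lemma eqmodX_mulr1 (A : comNzRingType) N (b P g : {poly A}) :
  eqmodX N (b * P) 1 -> eqmodX N (b * (g * P)) g.
Proof. by move=> bP t lttN; rewrite mulrCA (eqmodX_mull g bP lttN) mulr1. Qed.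

Lemma eqmodX_exp1 (A : nzRingType) N (P : {poly A}) m :
  eqmodX N P 1 -> eqmodX N (P ^+ m) 1.
Proof.
move=> P1 t lttN; elim: m t lttN => // m IH t lttN.
by rewrite exprS (eqmodX_mull P IH lttN) mulr1 P1.
Qed.

(** Truncated geometric series for the inverse of a [P] with constant term [c], in the form used by
    [hasse_frac]. *)
Definition geom_inv (F : fieldType) (P : {poly F}) (c : F) N :=
  \sum_(j < N) (c%:P - P) ^+ j * (c ^- j.+1)%:P.

Lemma geom_invE (F : fieldType) (P : {poly F}) (c : F) N : c != 0 ->
  geom_inv P c N = (\sum_(j < N) (1 - (c^-1)%:P * P) ^+ j) * (c^-1)%:P.
Proof.
move=> c0; rewrite mulr_suml; apply: eq_bigr => j _.
have -> : 1 - (c^-1)%:P * P = (c^-1)%:P * (c%:P - P).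
  by rewrite mulrBr -polyCM mulVf.
by rewrite exprMn mulrAC -!rmorphXn /= -polyCM -exprSr exprVn mulrC.
Qed.

Lemma geom_invP (F : fieldType) (P : {poly F}) (c : F) N : c != 0 -> P`_0 = c ->
  eqmodX N (P * geom_inv P c N) 1.
Proof.
move=> c0 P0; rewrite geom_invE //; set y := 1 - _.
have y0 : root y 0 by rewrite /root horner_coef0 coefB coefCM P0 mulVf // coef1 subrr.
have -> : P * ((\sum_(j < N) y ^+ j) * (c^-1)%:P) = 1 - y ^+ N.
  rewrite -[RHS]opprB subrX1 -mulNr opprB {2}/y opprB addrC addrNK.
  by rewrite mulrA mulrC mulrA.
(* [y] is a multiple of the variable, so [y ^+ N] has no coefficient below [N]. *)
have [z ->] := factor_theorem _ _ y0.
by move=> t lttN; rewrite subr0 coefB exprMn coefMXn lttN subr0.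
Qed.

(** * Counting multi-indices *)

Fixpoint box m T : seq (seq nat) :=
  if m is m'.+1 then [seq c :: b | c <- iota 0 T, b <- box m' T] else [:: [::]].

Lemma mem_box m T b : (b \in box m T) = (size b == m) && all (fun c => c < T)%N b.
Proof.
elim: m b => [|m IH] [|c b] //=; first by apply/allpairsP => -[[c b] []].
apply/allpairsP/idP => [[[c' b'] /= [+ + [-> ->]]]|].
  by rewrite mem_iota IH eqSS => /= -> /andP[-> ->].
rewrite eqSS => /and3P[sb cT bT]; exists (c, b) => /=.
by rewrite mem_iota IH sb cT bT.
Qed.

Lemma box_uniq m T : uniq (box m T).
Proof.
elim: m => //= m IH; apply: allpairs_uniq => //; first exact: iota_uniq.
by move=> [c b] [c' b'] /= _ _ [-> ->].
Qed.

Lemma ex_least (P : nat -> Prop) : (exists m, P m) ->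
  exists m, P m /\ forall m', (m' < m)%N -> ~ P m'.
Proof.
move=> [m Pm]; apply: NNPP => noleast.
suff noP : forall m', (m' < m.+1)%N -> ~ P m' by exact: (noP m).
elim: m.+1 => // l IH m' /[!ltnS] m'l Pm'; apply: noleast; exists m'; split=> //.
by move=> c /leq_trans/(_ m'l)/IH.
Qed.

Lemma sum_bin_diag m i : (\sum_(c < i.+1) 'C(m + c, m) = 'C(m.+1 + i, m.+1))%N.
Proof.
elim: i => [|i IH]; first by rewrite big_ord1 !addn0 !binn.
by rewrite big_ord_recr /= IH [in RHS]addSn binS addSnnS.
Qed.

Definition simplex m i := [seq b <- box m i.+1 | sumn b <= i]%N.

Lemma count_simplex m T i : (i < T)%N ->
  count (fun b => sumn b <= i)%N (box m T) = 'C(m + i, m).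
Proof.
elim: m i => [|m IH] i iT; first by rewrite /= bin0.
rewrite -sum1_count big_mkcond big_allpairs_dep /=.
have -> : iota 0 T = index_iota 0 T by rewrite /index_iota subn0.
(* First entries above [i] contribute nothing; the others, in reverse order, give the sum of
   [sum_bin_diag]. *)
rewrite (big_cat_nat (leq0n i.+1)) //= big_mkord -sum_bin_diag addnC.
rewrite big1_seq ?add0n; last first.
  move=> c /andP[_]; rewrite mem_index_iota => /andP[ic _].
  by rewrite big1 // => b _; rewrite leqNgt (leq_trans ic) ?leq_addr.
rewrite (reindex_inj rev_ord_inj); apply: eq_bigr => c _ /=.
have ci : (c <= i)%N by rewrite -ltnS.
rewrite -(IH c) ?(leq_ltn_trans ci iT) // -sum1_count [RHS]big_mkcond.
apply: eq_bigr => b _; rewrite subSS.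
by have -> : (i - c + sumn b <= i)%N = (sumn b <= c)%N by lia.
Qed.

Lemma size_simplex m i : size (simplex m i) = 'C(m + i, m).
Proof. by rewrite size_filter count_simplex. Qed.

Lemma mem_simplex m i b : (b \in simplex m i) = (size b == m) && (sumn b <= i)%N.
Proof.
rewrite mem_filter mem_box andbC; case: (size b == m) => //=.
apply: andb_idl => si; apply/allP => c; rewrite ltnS => cb.
apply: leq_trans si; elim: b cb => //= a b IH; rewrite inE => /orP[/eqP->|/IH].
  exact: leq_addr.
by move=> cb; apply: leq_trans cb (leq_addl _ _).
Qed.

Lemma simplex_uniq m i : uniq (simplex m i).
Proof. exact: filter_uniq (box_uniq _ _). Qed.

(** * Growth of binomial coefficients *)

Lemma expn_succ_le x m : (x.+1 ^ m.+1 <= x ^ m.+1 + m.+1 * x.+1 ^ m)%N.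
Proof.
elim: m => [|m IH]; first by rewrite !expn1 expn0 muln1 addn1.
rewrite expnS; apply: leq_trans (leq_mul (leqnn x.+1) IH) _.
have : (x ^ m.+1 <= x.+1 ^ m.+1)%N by rewrite leq_exp2r.
by rewrite ![(_ ^ m.+2)%N]expnS [(x.+1 ^ m.+1)%N]expnS; nia.
Qed.

Lemma ffact_lower m i : (i ^ m <= (m + i) ^_ m)%N.
Proof.
elim: m => [|m IH]; first by rewrite ffactn0.
rewrite addSn ffactSS expnS; apply: leq_mul => //.
by apply: leq_trans (leq_addl m i) _.
Qed.

Lemma ffact_upper m i : ((m + i) ^_ m <= (m + i) ^ m)%N.
Proof.
elim: m i => [|m IH] i; first by rewrite ffactn0.
rewrite addSnnS ffactnSr expnSr; apply: leq_mul; first exact: IH.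
exact: leq_subr.
Qed.

(** As polynomials in i, the two sides have i^n-coefficients l / n! and D^n / n!. Evaluating at
    multiples i = C r makes the comparison of leading terms explicit. *)
Lemma binomial_growth_bound n D l s :
  (forall i, l * 'C(n + i, n) <= 'C(n + D * (s + i), n))%N -> (l <= D ^ n)%N.
Proof.
move=> H; case: n H => [|n] H; first by have := H 0%N; rewrite !bin0 muln1.
(* Large enough to absorb the constant [n.+1 + D * s] at i = C r; the power of [C] then cancels. *)
set C := (n.+1 + D * s).+1.
have Hr r : (l * r ^ n.+1 <= (D * r).+1 ^ n.+1)%N.
  have : (l * (C * r) ^ n.+1 <= (C * (D * r).+1) ^ n.+1)%N.
    apply: leq_trans (leq_mul (leqnn l) (ffact_lower _ _)) _.
    rewrite -bin_ffact mulnA; apply: leq_trans (leq_mul (H _) (leqnn _)) _.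
    rewrite bin_ffact; apply: leq_trans (ffact_upper _ _) _.
    by rewrite leq_exp2r // /C; nia.
  by rewrite !expnMn mulnCA leq_pmul2l // expn_gt0.
rewrite leqNgt; apply/negP => lD.
(* If l > D^(n+1), the bounds leave r^(n+1) <= (n+1) (D+1)^n r^n, which this [r] violates. *)
set r := (n.+1 * D.+1 ^ n).+1.
have := leq_trans (leq_mul lD (leqnn _)) (leq_trans (Hr r) (expn_succ_le _ _)).
rewrite mulSn addnC expnMn leq_add2l; apply/negP; rewrite -ltnNge.
have r1 : ((D * r).+1 ^ n <= (D.+1 * r) ^ n)%N.
  by case: (n) => // m; rewrite leq_exp2r // mulSn -add1n leq_add2r.
apply: leq_ltn_trans (leq_mul (leqnn _) r1) _.
by rewrite expnMn mulnA expnS ltn_pmul2r ?expn_gt0.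
Qed.

Lemma mpoly_dependent (k : fieldType) (n : nat) (I : finType) (u : I -> {mpoly k[n]}) a :
  (forall x, msize (u x) <= a.+1)%N -> ('C(n + a, n) < #|I|)%N ->
  exists c : I -> k, (exists x, c x != 0) /\ \sum_x c x *: u x = 0.
Proof.
move=> ua lt_dim; set S := simplex n a.
pose mon b : 'X_{1..n} := [multinom nth 0%N b i | i < n].
pose A : 'M[k]_(#|I|, size S) :=
  \matrix_(x, y) (u (enum_val x))@_(mon (nth [::] S y)).
(* There are more polynomials than monomials of degree at most [a], so the coefficient matrix has a
   nonzero left kernel vector. *)
have : kermx A != 0.
  rewrite -mxrank_eq0 mxrank_ker subn_eq0 -ltnNge.
  by apply: leq_ltn_trans (rank_leq_col _) _; rewrite size_simplex.
case/rowV0Pn => v /sub_kermxP vA v0.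
exists (fun x => v 0 (enum_rank x)); split.
  have [x vx] : exists x, v 0 x != 0.
    apply/existsP; apply: contraNT v0; rewrite negb_exists => /forallP v0.
    by apply/eqP/rowP => x; rewrite mxE; apply/eqP; have := v0 x; rewrite negbK.
  by exists (enum_val x); rewrite enum_valK.
apply/mpolyP => m; rewrite raddf_sum /= mcoeff0.
have [ma|am] := leqP (mdeg m) a; last first.
  apply: big1 => x _; rewrite mcoeffZ memN_msupp_eq0 ?mulr0 //.
  by apply: msize_mdeg_ge; apply: leq_trans (ua x) am.
have mS : (m : seq nat) \in S.
  by rewrite mem_simplex size_tuple eqxx /= sumnE.
have mS' := mS; rewrite -index_mem in mS'.
have := congr1 (fun B : 'rV_(size S) => B 0 (Ordinal mS')) vA.
rewrite !mxE => vE; rewrite -[RHS]vE (reindex _ (onW_bij _ (enum_val_bij I))).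
apply: eq_bigr => x _; rewrite mcoeffZ enum_valK mxE /= nth_index //.
congr (_ * _@__); apply/mnmP => j; rewrite mnmE.
by rewrite /fun_of_multinom (tnth_nth 0%N).
Qed.

(** * Hasse derivatives on a fraction field *)

(* [A] stands for the polynomial ring, [phi] for its embedding in the fraction field
   [F], [tay i g] for the expansion of [g] at [x_i + T], and [deg u a] for
   [deg u <= a]. *)
Section Localization.
Variables (k : fieldType) (A : idomainType) (F : fieldType).
Variables (cst : {rmorphism k -> A}) (phi : {rmorphism A -> F}) (num den : F -> A).
Variables (n : nat) (tay : 'I_n -> {rmorphism A -> {poly A}}) (X : 'I_n -> A).
Variables (deg : A -> nat -> Prop) (f : A) (d : nat).
Hypothesis phi_eq0 : forall r, (phi r == 0) = (r == 0).
Hypothesis den_neq0 : forall q, den q != 0.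
Hypothesis num_den : forall q, q = phi (num q) / phi (den q).
Hypothesis tay_coef0 : forall i g, (tay i g)`_0 = g.
Hypothesis tay_cst : forall i c, tay i (cst c) = (cst c)%:P.
Hypothesis tayX : forall i j, tay i (X j) = (X j)%:P + (j == i)%:R * 'X.
Hypothesis degW : forall a b u, (a <= b)%N -> deg u a -> deg u b.
Hypothesis deg0 : deg 0 0.
Hypothesis deg1 : deg 1 0.
Hypothesis degX : forall i, deg (X i) 1.
Hypothesis degN : forall u a, deg u a -> deg (- u) a.
Hypothesis degD : forall u v a, deg u a -> deg v a -> deg (u + v) a.
Hypothesis degM : forall u v a b, deg u a -> deg v b -> deg (u * v) (a + b).
Hypothesis deg_tay : forall i g a l, deg g a -> deg (tay i g)`_l a.
Hypothesis deg_ex : forall u, exists a, deg u a.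
Hypothesis deg_dim : forall (I : finType) (u : I -> A) a,
  (forall x, deg (u x) a) -> ('C(n + a, n) < #|I|)%N ->
  exists c : I -> k, (exists x, c x != 0) /\ \sum_x cst (c x) * u x = 0.
Hypotheses (f0 : f != 0) (fd : deg f d).

Definition ftaylor (i : 'I_n) : A -> {poly F} := map_poly phi \o tay i.

HB.instance Definition _ i := GRing.RMorphism.on (ftaylor i).

Lemma ftaylor_coef i g t : (ftaylor i g)`_t = phi (tay i g)`_t.
Proof. by rewrite /ftaylor /= coef_map. Qed.

Lemma ftaylor_coef0 i g : (ftaylor i g)`_0 = phi g.
Proof. by rewrite ftaylor_coef tay_coef0. Qed.

Lemma ftaylor_coef0_neq0 i g : g != 0 -> (ftaylor i g)`_0 != 0.
Proof. by rewrite ftaylor_coef0 phi_eq0. Qed.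

Definition ftaylor_inv i (b : A) N : {poly F} := geom_inv (ftaylor i b) (phi b) N.

Lemma ftaylor_invP i (b : A) N : b != 0 ->
  eqmodX N (ftaylor i b * ftaylor_inv i b N) 1.
Proof. by move=> b0; apply: geom_invP; rewrite ?phi_eq0 // ftaylor_coef0. Qed.

Definition hasse_ratio i t (g b : A) : F := (ftaylor i g * ftaylor_inv i b t.+1)`_t.

Lemma hasse_ratio_unique i t (g b : A) (P : {poly F}) : b != 0 ->
  eqmodX t.+1 (ftaylor i b * P) (ftaylor i g) -> hasse_ratio i t g b = P`_t.
Proof.
move=> b0 bP.
have e : eqmodX t.+1
    (ftaylor i b * (ftaylor i g * ftaylor_inv i b t.+1)) (ftaylor i g).
  by apply: eqmodX_mulr1; apply: ftaylor_invP.
apply: (eqmodX_cancel (N := t.+1) (ftaylor_coef0_neq0 i b0) _ (ltnSn t)).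
by move=> l llt; rewrite (bP l llt); apply: e.
Qed.

(** An operator on field elements, through a chosen representative; [hasse_ratioE] shows that the
    choice is immaterial. *)
Definition hasse i t (q : F) : F := hasse_ratio i t (num q) (den q).

Lemma hasse_unique i t q (g b : A) (P : {poly F}) : b != 0 -> q = phi g / phi b ->
  eqmodX t.+1 (ftaylor i b * P) (ftaylor i g) -> hasse i t q = P`_t.
Proof.
move=> b0 qE bP; apply: (hasse_ratio_unique (den_neq0 q)).
apply: (eqmodX_cross (ftaylor_coef0_neq0 i b0) _ bP).
apply/eqP; rewrite -subr_eq0 -phi_eq0 rmorphB !rmorphM subr_eq0.
by rewrite -eqr_div ?phi_eq0 // -qE {1}[q]num_den.
Qed.

Lemma hasse_ratioE i t (g b : A) : b != 0 ->
  hasse i t (phi g / phi b) = hasse_ratio i t g b.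
Proof.
move=> b0; apply: (hasse_unique b0 erefl).
by apply: eqmodX_mulr1; apply: ftaylor_invP.
Qed.

(** One fraction and one series serve all orders below [N], so that rules for [hasse] become
    identities of series. *)
Lemma hasse_series i N q : exists (g b : A) (P : {poly F}), [/\ b != 0,
  q = phi g / phi b,
  eqmodX N (ftaylor i b * P) (ftaylor i g) &
  forall t, (t < N)%N -> hasse i t q = P`_t].
Proof.
exists (num q), (den q), (ftaylor i (num q) * ftaylor_inv i (den q) N).
have e : eqmodX N (ftaylor i (den q) *
    (ftaylor i (num q) * ftaylor_inv i (den q) N)) (ftaylor i (num q)).
  by apply: eqmodX_mulr1; apply: ftaylor_invP.
split=> // t ltN; apply: (hasse_unique (den_neq0 q) (num_den q)) => l llt.
by apply: e; apply: leq_trans llt _.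
Qed.

Lemma hasse0 i q : hasse i 0 q = q.
Proof.
have [g [b [P [b0 -> /(_ 0%N erefl) e /(_ 0%N erefl) ->]]]] := hasse_series i 1 q.
apply: (canRL (mulfK _)); first by rewrite phi_eq0.
by move: e; rewrite coef0M !ftaylor_coef0 mulrC.
Qed.

(** The Leibniz rule: Taylor expansion is multiplicative. *)
Lemma hasseM i t r q : hasse i t (phi r * q) =
  \sum_(l < t.+1) phi (tay i r)`_l * hasse i (t - l) q.
Proof.
have [g [b [P [b0 qE e eP]]]] := hasse_series i t.+1 q.
rewrite (hasse_unique (g := r * g) (b := b) (P := ftaylor i r * P)) //.
- rewrite coefM; apply: eq_bigr => l _.
  by rewrite ftaylor_coef eP // ltnS leq_subr.
- by rewrite qE rmorphM mulrA.
- by move=> l llt; rewrite mulrCA (eqmodX_mull _ e) // rmorphM.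
Qed.

(** * The filtration by pole order and degree *)

Lemma deg_exp u a m : deg u a -> deg (u ^+ m) (a * m).
Proof.
move=> ua; elim: m => [|m IH]; first by rewrite expr0 muln0.
by rewrite exprS mulnS; apply: degM.
Qed.

Definition frac_bd s a (q : F) :=
  exists u : A, deg u a /\ q = phi u / phi f ^+ s.

Let phif0 m : phi f ^+ m != 0.
Proof. by rewrite expf_neq0 ?phi_eq0. Qed.

Lemma frac_bdW s a b q : (a <= b)%N -> frac_bd s a q -> frac_bd s b q.
Proof. by move=> ab [u [ua qE]]; exists u; split=> //; apply: degW ua. Qed.

Lemma frac_bd_raise s a m q : frac_bd s a q -> frac_bd (s + m) (a + d * m) q.
Proof.
move=> [u [ua ->]]; exists (u * f ^+ m); split.
  by apply: degM => //; apply: deg_exp.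
by rewrite rmorphM rmorphXn /= exprD -mulf_div divff ?mulr1.
Qed.

Lemma frac_bd0 s a : frac_bd s a 0.
Proof. by exists 0; rewrite rmorph0 mul0r; split=> //; apply: degW deg0. Qed.

Lemma frac_bdD s a q1 q2 :
  frac_bd s a q1 -> frac_bd s a q2 -> frac_bd s a (q1 + q2).
Proof.
move=> [u [ua ->]] [v [va ->]]; exists (u + v); rewrite rmorphD mulrDl.
by split=> //; apply: degD.
Qed.

Lemma frac_bdM s1 s2 a1 a2 q1 q2 :
  frac_bd s1 a1 q1 -> frac_bd s2 a2 q2 -> frac_bd (s1 + s2) (a1 + a2) (q1 * q2).
Proof.
move=> [u [ua ->]] [v [va ->]]; exists (u * v); split; first exact: degM.
by rewrite rmorphM exprD mulf_div.
Qed.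

(* Bounded series form a graded ring, which bounds the Taylor expansion of [g / f^s]
   without the large denominators occurring in [hasse_ratio]. *)
Definition ser_bd s a (P : {poly F}) := forall l, frac_bd (s + l) (a + d * l) P`_l.

Lemma ser_bdD s a P Q : ser_bd s a P -> ser_bd s a Q -> ser_bd s a (P + Q).
Proof. by move=> Pb Qb l; rewrite coefD; apply: frac_bdD. Qed.

Lemma ser_bdM s1 s2 a1 a2 P Q :
  ser_bd s1 a1 P -> ser_bd s2 a2 Q -> ser_bd (s1 + s2) (a1 + a2) (P * Q).
Proof.
move=> Pb Qb l; rewrite coefM.
apply: (big_ind (frac_bd (s1 + s2 + l) (a1 + a2 + d * l))).
- exact: frac_bd0.
- by move=> *; apply: frac_bdD.
move=> [j /= jl] _.
have -> : (s1 + s2 + l = s1 + j + (s2 + (l - j)))%N by lia.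
have -> : (a1 + a2 + d * l = a1 + d * j + (a2 + d * (l - j)))%N by nia.
exact: frac_bdM.
Qed.

Lemma ser_bdC s a q : frac_bd s a q -> ser_bd s a q%:P.
Proof.
move=> qb [|l]; rewrite coefC /=; last exact: frac_bd0.
by rewrite addn0 muln0 addn0.
Qed.

Lemma ser_bdX s a P m : ser_bd s a P -> ser_bd (s * m) (a * m) (P ^+ m).
Proof.
move=> Pb; elim: m => [|m IH]; last by rewrite exprS !mulnS; apply: ser_bdM.
rewrite !muln0 expr0; apply: ser_bdC.
by exists 1; rewrite rmorph1 expr0 divr1.
Qed.

Lemma ser_bd_ftaylor i (g : A) a : deg g a -> ser_bd 0 a (ftaylor i g).
Proof.
move=> ga l; rewrite ftaylor_coef; apply: frac_bd_raise.
by exists (tay i g)`_l; rewrite expr0 divr1; split=> //; apply: deg_tay.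
Qed.

(** The factor 1 - T(f)/f of the geometric series has no constant term, and a pole of order 1 <= l
    in its l-th coefficient, so its powers need no shift; the final factor 1/f gives the shift by
    one. *)
Lemma ser_bd_ftaylor_inv i N : ser_bd 1 0 (ftaylor_inv i f N).
Proof.
rewrite /ftaylor_inv geom_invE ?phi_eq0 //; apply: (@ser_bdM 0 1 0 0); last first.
  by apply: ser_bdC; exists 1; rewrite rmorph1 expr1 div1r.
apply: (big_ind (ser_bd 0 0)) => [l|P Q|j _]; last 1 first.
- rewrite -[X in ser_bd X](mul0n j) -[X in ser_bd _ X](mul0n j).
  apply: ser_bdX => l; rewrite coefB coef1 coefCM ftaylor_coef add0n.
  case: l => [|l] /=.
    by rewrite tay_coef0 mulVf ?phi_eq0 // subrr; apply: frac_bd0.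
  rewrite sub0r -[l.+1]add1n mulnDr muln1; apply: frac_bd_raise.
  exists (- (tay i f)`_(1 + l)); rewrite expr1 rmorphN mulNr mulrC.
  by split=> //; apply: degN; apply: deg_tay.
- by rewrite coef0; apply: frac_bd0.
- exact: ser_bdD.
Qed.

(** The space G_s. Raising the pole order by one costs degree d, and the slope d+1 leaves one more
    degree for a variable. *)
Definition bfilt s := frac_bd s (d.+1 * s).

Lemma bfilt_hasse i t s q : bfilt s q -> bfilt (s + t) (hasse i t q).
Proof.
move=> [g [gs qE]].
(* The s-th power of the inverse of f replaces the inverse of f^s, since [ser_bd_ftaylor_inv] bounds
   its coefficients. *)
rewrite (hasse_unique (g := g) (b := f ^+ s)
  (P := ftaylor i g * ftaylor_inv i f t.+1 ^+ s)).
- apply: (@frac_bdW _ (d.+1 * s + d * t)); first by nia.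
  have := ser_bdM (ser_bd_ftaylor i gs) (ser_bdX s (ser_bd_ftaylor_inv i t.+1)).
  by move/(_ t); rewrite !add0n mul1n mul0n addn0.
- by rewrite expf_neq0.
- by rewrite rmorphXn.
rewrite mulrCA rmorphXn -exprMn.
have e := eqmodX_exp1 s (@ftaylor_invP i f t.+1 f0).
by move=> l llt; rewrite (eqmodX_mull _ e llt) mulr1.
Qed.

Lemma bfiltX i s q : bfilt s q -> bfilt s.+1 (phi (X i) * q).
Proof.
move=> /(frac_bd_raise 1) qb.
apply: (@frac_bdW _ (1 + (d.+1 * s + d * 1))); first by lia.
rewrite -[s.+1]addn1 -[(s + 1)%N]add0n; apply: frac_bdM => //.
by exists (X i); rewrite expr0 divr1.
Qed.

Lemma bfiltW s t q : (s <= t)%N -> bfilt s q -> bfilt t q.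
Proof.
move=> st /(frac_bd_raise (t - s)); rewrite subnKC //.
by apply: frac_bdW; nia.
Qed.

(** Multiplying through by f^a turns the degree bound [a] into (d+1) a, which the level m + a
    allows. *)
Lemma bfilt_exhaustive g a m : deg g a -> bfilt (m + a) (phi g / phi f ^+ m).
Proof.
move=> ga; apply: (@frac_bdW _ (a + d * a)); first by nia.
by apply: frac_bd_raise; exists g.
Qed.

(** * Independent families in D-modules *)

Section Independence.
Variable N : F -> Prop.
Hypothesis N0 : N 0.
Hypothesis ND : forall q1 q2, N q1 -> N q2 -> N (q1 + q2).
Hypothesis NM : forall r q, N q -> N (phi r * q).
Hypothesis NH : forall i t q, N q -> N (hasse i t q).

Lemma subN_opp q : N q -> N (- q).
Proof. by move=> /(NM (-1)); rewrite rmorphN1 mulN1r. Qed.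

Lemma subN_sum (I : Type) (r : seq I) (P : pred I) (E : I -> F) :
  (forall i, P i -> N (E i)) -> N (\sum_(i <- r | P i) E i).
Proof. by move=> NE; apply: (big_ind N). Qed.

Lemma subN_trans q1 q2 : N (q1 - q2) -> N q1 -> N q2.
Proof. by move=> N12 N1; rewrite -(subKr q1 q2); apply: ND N1 (subN_opp N12). Qed.

(* [r] involves only the variables of index less than [j]. *)
Definition free j r := forall i : 'I_n, (j <= i)%N -> tay i r = r%:P.

Lemma hasse_free j r (i : 'I_n) t q : free j r -> (j <= i)%N ->
  hasse i t (phi r * q) = phi r * hasse i t q.
Proof.
move=> fr ji; rewrite hasseM big_ord_recl tay_coef0 subn0 big1 ?addr0 // => l _.
by rewrite fr // coefC /= rmorph0 mul0r.
Qed.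

Lemma tay_horner (i : 'I_n) (G : {poly A}) : (forall c, free i G`_c) ->
  forall l, (tay i G.[X i])`_l = G^`N(l).[X i].
Proof.
move=> fG l.
have -> : tay i G.[X i] = (map_poly polyC G).[(X i)%:P + 'X].
  rewrite horner_coef rmorph_sum horner_coef size_map_polyC; apply: eq_bigr => c _.
  by rewrite rmorphM rmorphXn /= tayX eqxx mul1r coef_map /= fG.
rewrite nderiv_taylor; last exact: mulrC.
rewrite size_map_polyC (eq_bigr (fun l : 'I_(size G) => G^`N(l).[X i] *: 'X^l)).
  rewrite -(poly_def _ (fun l => G^`N(l).[X i])) coef_poly; case: ltnP => // sGl.
  by rewrite nderivn_poly0 // horner0.
by move=> c _; rewrite nderivn_map horner_map mul_polyC.
Qed.

Lemma free_horner (i : 'I_n) (G : {poly A}) :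
  (forall c, free i G`_c) -> free i.+1 G.[X i].
Proof.
move=> fG i' ii'; rewrite horner_coef !rmorph_sum; apply: eq_bigr => c _.
rewrite !rmorphM !rmorphXn /= tayX (fG c i' (ltnW ii')) -val_eqE ltn_eqF //.
by rewrite mul0r addr0.
Qed.

Section PowerReduction.
Variables (i : 'I_n) (G : {poly A}) (q : nat) (w : F).
Hypothesis freeG : forall c, free i G`_c.
Hypothesis q_gt0 : (0 < q)%N.
Hypothesis Gq : forall l, (0 < l < q)%N -> G^`N(l) = 0.
Hypothesis Nw : N (phi G.[X i] * w).
Local Notation g := G.[X i].
Local Notation gq := (G^`N(q).[X i]).

(** Apply D^(b) to [g * w] in N, expand by Leibniz and multiply by g^m. The terms with 0 < l < q
    vanish, and those with l > q fall under the induction hypothesis; l = q survives only for b = q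
    (m+1), where it produces the next factor -G^[q]. *)
Lemma power_reduction m :
  (forall b, (b < q * m)%N -> N (phi g ^+ m * hasse i b w)) /\
  N (phi g ^+ m * hasse i (q * m) w - phi (- gq) ^+ m * w).
Proof.
elim: m => [|m [IHlt IHeq]].
  by split=> [b|]; rewrite muln0 // hasse0 !expr0 subrr.
have step b : N (phi g ^+ m.+1 * hasse i b w +
    \sum_(l < b) phi G^`N(l.+1).[X i] * (phi g ^+ m * hasse i (b - l.+1) w)).
  have := NM (g ^+ m) (NH i b Nw).
  rewrite hasseM big_ord_recl tay_coef0 subn0 mulrDr mulr_sumr mulrA rmorphXn -exprSr.
  congr (N (_ + _)); apply: eq_bigr => l _.
  by rewrite lift0 tay_horner // mulrCA.
split=> [b bq|].
  apply: subN_trans (step b); rewrite addrAC subrr add0r; apply: subN_sum => l _.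
  case: (ltnP l.+1 q) => lq; first by rewrite Gq // horner0 rmorph0 mul0r.
  by apply/NM/IHlt; have := ltn_ord l; have := mulnS q m; lia.
apply: subN_trans (step (q * m.+1)%N).
have lq : (q.-1 < q * m.+1)%N by rewrite mulnS; lia.
rewrite (bigD1 (Ordinal lq)) //= prednK //.
have -> : (q * m.+1 - q = q * m)%N by rewrite mulnS addKn.
set S := \sum_(_ < _ | _) _.
have NS : N S.
  apply: subN_sum => l; rewrite -val_eqE /= => lneq.
  case: (ltnP l.+1 q) => lq'; first by rewrite Gq // horner0 rmorph0 mul0r.
  by apply/NM/IHlt; have := ltn_ord l; have := mulnS q m; lia.
have := ND NS (NM gq IHeq); congr N.
rewrite rmorphN !exprS; ring.
Qed.

End PowerReduction.

(* The state after treating the variables of index less than [j]. *)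
Record stage j (M : F -> Prop) (B : A -> Prop) : Prop := Stage {
  stage_sub : forall q, N q -> M q;
  stage_add : forall q1 q2, M q1 -> M q2 -> M (q1 + q2);
  stage_mul : forall r q, M q -> M (phi r * q);
  stage_D : forall (i : 'I_n) t q, (j <= i)%N -> M q -> M (hasse i t q);
  stage_filt : forall q, M q -> exists s, bfilt s q;
  stage_proper : exists2 w, M w & ~ N w;
  stage_coef0 : B 0;
  stage_coefD : forall r1 r2, B r1 -> B r2 -> B (r1 + r2);
  stage_free : forall r, B r -> free j r;
  stage_inj : forall r w, B r -> r != 0 -> M w -> N (phi r * w) -> N w }.

(** Boxes exhaust N^m, so every finite relation is tested. *)
Definition indep m (B : A -> Prop) (e : seq nat -> F) :=
  forall T (r : seq nat -> A), (forall b, B (r b)) ->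
  N (\sum_(b <- box m T) phi (r b) * e b) ->
  forall b, b \in box m T -> r b = 0.

Definition frame m (M : F -> Prop) (B : A -> Prop) :=
  exists (e : seq nat -> F) (s : nat), [/\
    forall b, size b = m -> M (e b),
    forall b, size b = m -> bfilt (s + sumn b) (e b) & indep m B e].

Lemma frame0 j M B : stage j M B -> frame 0 M B.
Proof.
move=> st; have [w Mw Nw] := stage_proper st.
have [s fw] := stage_filt st Mw.
exists (fun=> w), s; split=> [//|b /size0nil -> |T r Br].
  by rewrite addn0.
rewrite big_seq1 => Nrw b; rewrite inE => /eqP ->.
have [//|r0] := eqVneq (r [::]) 0.
by case: Nw; apply: (stage_inj st _ r0 Mw Nrw).
Qed.

(** * Treating one more variable *)

Section Step.
Variables (i : 'I_n) (M : F -> Prop) (B : A -> Prop).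
Hypothesis st : stage i M B.

Definition over_B (G : {poly A}) := forall c, B G`_c.
Definition injective_on (g : A) := forall w, M w -> N (phi g * w) -> N w.
(** The coefficient space after the step; [Q] is always true in the torsion-free case and bounds the
    size by q in the torsion case. *)
Definition evals (Q : pred nat) (r : A) :=
  exists H : {poly A}, [/\ over_B H, Q (size H) & r = H.[X i]].

Lemma over_B_free G : over_B G -> forall c, free i G`_c.
Proof. by move=> BG c; apply: stage_free st _ _. Qed.

(** M / N is nonzero, so 0 does not act injectively. This lets coefficients be read off from a
    vanishing value. *)
Lemma injective_on_neq0 (H : {poly A}) :
  (H != 0 -> injective_on H.[X i]) -> H.[X i] = 0 -> H = 0.
Proof.
move=> injH Hx; have [//|H0] := eqVneq H 0; have [w Mw []] := stage_proper st.
by apply: (injH H0 w Mw); rewrite Hx rmorph0 mul0r.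
Qed.

Lemma B_mulrn r m : B r -> B (r *+ m).
Proof.
move=> Br; elim: m => [|m IH]; first by rewrite mulr0n; apply: stage_coef0 st.
by rewrite mulrS; apply: stage_coefD st _ _ Br IH.
Qed.

Lemma B_sum (I : Type) (s : seq I) (P : pred I) (E : I -> A) :
  (forall c, P c -> B (E c)) -> B (\sum_(c <- s | P c) E c).
Proof.
move=> BE; apply: (big_ind B) => //; first exact: stage_coef0 st.
exact: stage_coefD st.
Qed.

Lemma evals_stage (M' : F -> Prop) (Q : pred nat) :
  (forall q, N q -> M' q) -> (forall q, M' q -> M q) ->
  (forall q1 q2, M' q1 -> M' q2 -> M' (q1 + q2)) ->
  (forall r q, M' q -> M' (phi r * q)) ->
  (forall (i' : 'I_n) t q, (i < i')%N -> M' q -> M' (hasse i' t q)) ->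
  (exists2 w, M' w & ~ N w) ->
  Q 0%N -> (forall a b c, (c <= maxn a b)%N -> Q a -> Q b -> Q c) ->
  (forall H, over_B H -> Q (size H) -> H != 0 -> injective_on H.[X i]) ->
  stage i.+1 M' (evals Q).
Proof.
move=> NM' M'M M'D M'M' M'H M'p Q0 QD Qinj; split=> //.
- by move=> q /M'M; apply: stage_filt st _.
- exists 0; rewrite size_poly0 horner0; split=> // c; rewrite coef0.
  exact: stage_coef0 st.
- move=> _ _ [H1 [B1 Q1 ->]] [H2 [B2 Q2 ->]]; exists (H1 + H2); split.
  + by move=> c; rewrite coefD; apply: stage_coefD st _ _ _ _.
  + exact: QD (size_polyD _ _) Q1 Q2.
  + by rewrite hornerD.
- by move=> _ [H [BH _ ->]]; apply: free_horner; apply: over_B_free.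
- move=> _ w [H [BH QH ->]] Hx /M'M; apply: (Qinj H BH QH).
  by apply: contraNneq Hx => ->; rewrite horner0.
Qed.

Lemma step_torsionfree m :
  (forall G, over_B G -> G != 0 -> injective_on G.[X i]) ->
  (forall M' B', stage i.+1 M' B' -> frame m M' B') -> frame m.+1 M B.
Proof.
move=> inj IH.
have /IH[e [s [Me fe ie]]] : stage i.+1 M (evals xpredT).
  apply: evals_stage => //; try by case: st.
  - by move=> i' t q ii'; apply: stage_D st _ _ _ (ltnW ii').
  - by move=> H BH _; apply: inj.
exists (fun b => phi (X i) ^+ head 0%N b * e (behead b)), s; split.
- move=> [//|c b] /= [sb]; rewrite -rmorphXn.
  exact: (stage_mul st _ (Me b sb)).
- move=> [//|c b] /= [sb]; elim: c => [|c IHc]; first by rewrite mul1r; apply: fe.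
  by rewrite exprS -mulrA addSn addnS; apply: bfiltX.
move=> T r Br; rewrite big_allpairs_dep exchange_big /= => Nsum.
(* Coefficients with the same tail [b] form a polynomial in x_i, an admissible coefficient of
   [e b]. *)
pose H b := \sum_(c <- iota 0 T) (r (c :: b))%:P * 'X^c.
have BH b : over_B (H b).
  move=> a; rewrite coef_sum; apply: B_sum => c _; rewrite coefCM coefXn.
  by case: eqP => _; rewrite ?mulr1 // mulr0; apply: stage_coef0 st.
have H0 b : b \in box m T -> (H b).[X i] = 0.
  apply: (ie T (fun b => (H b).[X i])); first by move=> b'; exists (H b').
  move: Nsum; congr N; apply: eq_bigr => b' _.
  rewrite horner_sum rmorph_sum mulr_suml; apply: eq_bigr => c _.
  by rewrite hornerM hornerC hornerXn rmorphM rmorphXn mulrA.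
move=> _ /allpairsP[[c b] /= [cT bT ->]].
have /(congr1 (fun P : {poly A} => P`_c)) := injective_on_neq0 (inj _ (BH b)) (H0 b bT).
rewrite coef0 coef_sum (bigD1_seq c) ?iota_uniq //= coefCM coefXn eqxx mulr1.
rewrite big1 ?addr0 // => c' c'c; rewrite coefCM coefXn eq_sym (negbTE c'c).
by rewrite mulr0.
Qed.

Lemma step_torsion m (G : {poly A}) : over_B G -> G != 0 ->
  (exists w, [/\ M w, N (phi G.[X i] * w) & ~ N w]) ->
  (forall H, over_B H -> H != 0 -> (size H < size G)%N -> injective_on H.[X i]) ->
  (forall M' B', stage i.+1 M' B' -> frame m M' B') -> frame m.+1 M B.
Proof.
move=> BG G0 [w0 [Mw0 Ngw0 Nw0]] Gmin IH; set g := G.[X i].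
(* A constant G lies in B and acts injectively, contrary to the choice of [w0]. *)
have sG : (1 < size G)%N.
  rewrite ltnNge; apply/negP => /size1_polyC GE; apply: Nw0.
  apply: (stage_inj st (BG 0%N) _ Mw0).
    by apply: contraNneq G0 => G00; rewrite GE G00.
  by rewrite GE hornerC in Ngw0.
have exq : exists t, (0 < t)%N && (G^`N(t) != 0).
  (* The divided derivative of top order has the leading coefficient as constant term, in every
     characteristic. *)
  exists (size G).-1; rewrite -ltnS prednK ?(ltnW sG) // sG /=.
  apply: contraNneq G0 => /(congr1 (fun P : {poly A} => P`_0)).
  rewrite coef_nderivn coef0 addn0 binn mulr1n => lc0.
  by rewrite -lead_coef_eq0 lead_coefE lc0.
case: (ex_minnP exq) => q /andP[q0 Gq0] qmin.
have qG : (q < size G)%N.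
  by rewrite ltnNge; apply: contra Gq0 => /nderivn_poly0 ->.
have Gq l : (0 < l < q)%N -> G^`N(l) = 0.
  move=> /andP[l0 lq]; apply/eqP; apply: contraTT lq => Gl.
  by rewrite -leqNgt; apply: qmin; rewrite l0.
pose M' w := M w /\ N (phi g * w).
have inj_small H : over_B H -> (size H <= q)%N -> H != 0 -> injective_on H.[X i].
  by move=> BH sH H0; apply: Gmin => //; apply: leq_ltn_trans sH qG.
have /IH[e [s [Me fe ie]]] : stage i.+1 M' (evals (fun a => a <= q)%N).
  apply: evals_stage => //.
  - by move=> r Nr; split; [apply: stage_sub st _ Nr | apply: NM].
  - by move=> r [].
  - move=> q1 q2 [M1 N1] [M2 N2]; split; first exact: stage_add st _ _ M1 M2.
    by rewrite mulrDr; apply: ND.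
  - move=> r w [Mw Nw]; split; first exact: stage_mul st _ _ Mw.
    by rewrite mulrCA; apply: NM.
  - move=> i' t w ii' [Mw Nw]; split; first exact: stage_D st _ _ _ (ltnW ii') Mw.
    have fg : free i.+1 g by apply: free_horner; apply: over_B_free.
    by rewrite -(hasse_free _ _ fg ii'); apply: NH.
  - by exists w0.
  - by move=> a b c cab aq bq; apply: leq_trans cab _; rewrite geq_max aq.
pose gq := G^`N(q).[X i].
(* G^[q] is nonzero and of smaller size than G, so minimality applies. *)
have injq : injective_on gq.
  apply: Gmin => //; first by move=> c; rewrite coef_nderivn; apply: B_mulrn.
  by apply: leq_ltn_trans (size_poly _ _) _; rewrite ltn_subrL q0 (ltnW sG).
have inj_gq l v : M v -> N (phi (- gq) ^+ l * v) -> N v.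
  move=> Mv; elim: l => [|l IHl]; first by rewrite mul1r.
  rewrite exprS -mulrA => /subN_opp; rewrite -mulNr -rmorphN opprK => Nv.
  apply: IHl; apply: injq Nv.
  by rewrite -rmorphXn; apply: stage_mul st _ _ Mv.
(* Division with remainder by q gives exactly one operator for each weight c. *)
exists (fun b => phi (X i) ^+ (head 0 b %% q)%N *
   hasse i (head 0 b %/ q * q)%N (e (behead b))), s; split.
- move=> [//|c b] /= [sb]; rewrite -rmorphXn.
  by apply: (stage_mul st); apply: (stage_D st) => //; have [] := Me b sb.
- move=> [//|c b] /= [sb].
  have fX a v t : bfilt t v -> bfilt (t + a) (phi (X i) ^+ a * v).
    move=> fv; elim: a => [|a IHa]; first by rewrite addn0 mul1r.
    by rewrite exprS -mulrA addnS; apply: bfiltX.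
  have -> : (s + (c + sumn b) = s + sumn b + c %/ q * q + c %% q)%N.
    by rewrite {1}(divn_eq c q); lia.
  by apply: fX; apply: bfilt_hasse; apply: fe.
move=> T r Br; rewrite big_allpairs_dep exchange_big /= => Nsum.
(* Descending induction on the quotient c / q; the start l = T is vacuous because c / q <= c < T. *)
suff vanish l : (forall c b, (c < T)%N -> b \in box m T -> (l <= c %/ q)%N ->
      r (c :: b) = 0) ->
    forall c b, (c < T)%N -> b \in box m T -> r (c :: b) = 0.
  move=> _ /allpairsP[[c b] /= [cT bT ->]]; move: cT; rewrite mem_iota /= => cT.
  apply: (vanish T) => // c' b' c'T _ Tc'; have := leq_trans c'T Tc'.
  by rewrite ltnNge leq_div.
elim: l => [|l IHl] vl; first by move=> c b cT bT; apply: vl.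
apply: IHl => c b cT bT lc.
have [lc'|cl] := ltnP l (c %/ q); first exact: vl.
have {lc cl} cl : (c %/ q = l)%N by apply/eqP; rewrite eqn_leq cl lc.
(* The part of quotient l, as a polynomial in x_i of size at most q. *)
pose H b := \sum_(a <- iota 0 T | (a %/ q == l)%N) (r (a :: b))%:P * 'X^(a %% q)%N.
have BH b' : over_B (H b').
  move=> a; rewrite coef_sum; apply: B_sum => a' _; rewrite coefCM coefXn.
  by case: eqP => _; rewrite ?mulr1 // mulr0; apply: stage_coef0 st.
have sH b' : (size (H b') <= q)%N.
  apply/leq_sizeP => a qa; rewrite coef_sum big1 // => a' _.
  by rewrite coefCM coefXn gtn_eqF ?mulr0 // (leq_trans _ qa) // ltn_mod.
have Hx b' : b' \in box m T -> (H b').[X i] = 0.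
  apply: (ie T (fun b => (H b).[X i])); first by move=> b1; exists (H b1).
  (* Multiplying the relation by g^l sends smaller quotients into N and turns quotient l into
     (-G^[q])^l times a power of x_i; larger quotients vanish by [vl]. Injectivity then cancels
     (-G^[q])^l. *)
  apply: (inj_gq l).
    rewrite big_seq; apply: (big_ind M) => [||b1].
    - exact: stage_sub st _ N0.
    - exact: stage_add st.
    rewrite mem_box => /andP[/eqP sb1 _]; apply: (stage_mul st).
    by have [] := Me b1 sb1.
  move: (NM (g ^+ l) Nsum); apply: subN_trans.
  rewrite !mulr_sumr -sumrB big_seq; apply: subN_sum => b1 b1T.
  have sb1 : size b1 = m by move: b1T; rewrite mem_box => /andP[/eqP].
  rewrite horner_sum rmorph_sum mulr_suml !mulr_sumr [X in _ - X]big_mkcond.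
  rewrite -sumrB big_seq.
  apply: subN_sum => a; rewrite mem_iota /= => aT.
  have [plt peq] := power_reduction (over_B_free BG) q0 Gq (proj2 (Me b1 sb1)) l.
  have [al|la|al] := ltngtP (a %/ q) l.
  - rewrite subr0 rmorphXn -/g [phi g ^+ l * _]mulrCA [phi g ^+ l * _]mulrCA -rmorphXn.
    by apply/NM/NM/plt; rewrite mulnC ltn_mul2l q0.
  - by rewrite vl // rmorph0 !mul0r mulr0 subrr.
  rewrite al hornerM hornerC hornerXn rmorphM !rmorphXn [(l * q)%N]mulnC.
  move: (NM (r (a :: b1)) (NM (X i ^+ (a %% q)%N) peq)); congr N.
  by rewrite rmorphXn -/g -/gq; ring.
have Hb : H b = 0.
  by apply: injective_on_neq0 (Hx b bT) => H0; apply: inj_small.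
have := congr1 (fun P : {poly A} => P`_(c %% q)%N) Hb.
rewrite coef0 coef_sum big_mkcond (bigD1_seq c) ?iota_uniq ?mem_iota //= cl eqxx.
rewrite coefCM coefXn eqxx mulr1 big1 ?addr0 // => c' c'c; case: eqP => // c'l.
rewrite coefCM coefXn; case: eqP => [cc'|_]; last by rewrite mulr0.
by move: c'c; rewrite (divn_eq c q) (divn_eq c' q) cl c'l cc' eqxx.
Qed.

End Step.

Lemma stage_frame m j M B : (j + m = n)%N -> stage j M B -> frame m M B.
Proof.
elim: m j M B => [|m IH] j M B; first by move=> _; apply: frame0.
rewrite addnS => jmn; have jn : (j < n)%N by rewrite -jmn ltnS leq_addr.
pose i := Ordinal jn => st; have sti : stage i M B by [].
have {}IH M' B' : stage i.+1 M' B' -> frame m M' B' by apply: IH; rewrite addSn.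
(* A least [bad] size provides the minimality that [step_torsion] asks for; if there is none, the
   torsion-free step applies. *)
pose bad s := exists G, [/\ over_B B G, G != 0, size G = s &
  exists w, [/\ M w, N (phi G.[X i] * w) & ~ N w]].
have [/ex_least[s [[G [BG G0 Gs Gw]] smin]]|nobad] := classic (exists s, bad s).
  apply: (step_torsion sti BG G0 Gw) IH => H BH H0 sH w Mw NHw.
  apply: NNPP => Nw; apply: (smin (size H)); first by rewrite -Gs.
  by exists H; split=> //; exists w.
apply: (step_torsionfree sti) IH => G BG G0 w Mw NGw.
apply: NNPP => Nw; apply: nobad; exists (size G), G; split=> //.
by exists w.
Qed.

End Independence.

(** * Chains of D-stable subspaces *)

Record Dstable (N : F -> Prop) : Prop := {
  Dstable_filt : forall q, N q -> exists s, bfilt s q;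
  Dstable0 : N 0;
  DstableD : forall q1 q2, N q1 -> N q2 -> N (q1 + q2);
  DstableM : forall r q, N q -> N (phi r * q);
  Dstable_op : forall i t q, N q -> N (hasse i t q) }.

(** Before any variable is treated, the coefficients are the constants, and a nonzero constant acts
    invertibly. *)
Lemma Dstable_frame (N W : F -> Prop) : Dstable N -> Dstable W -> sstrict N W ->
  frame N n W (fun r => exists c, r = cst c).
Proof.
move=> [_ N0 ND NM NH] [Wf W0 WD WM WH] [NW [w [Ww Nw]]].
apply: (stage_frame N0 ND NM NH (j := 0)) => //.
split=> //.
- by move=> i t q _; apply: WH.
- by exists w.
- by exists 0; rewrite rmorph0.
- by move=> _ _ [c ->] [c' ->]; exists (c + c'); rewrite rmorphD.
- by move=> _ [c ->] i _.
move=> _ v [c ->] c0 _ /(NM (cst c^-1)).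
rewrite mulrA -!rmorphM mulVf ?rmorph1 ?mul1r //.
by apply: contraNneq c0 => ->; rewrite rmorph0.
Qed.

Lemma bfilt_dependent (I : finType) (v : I -> F) s :
  (forall x, bfilt s (v x)) -> ('C(n + d.+1 * s, n) < #|I|)%N ->
  exists c : I -> k, (exists x, c x != 0) /\ \sum_x phi (cst (c x)) * v x = 0.
Proof.
move=> /fin_all_exists[u uE] /deg_dim-/(_ u)[x|c [c0 cu]]; first by have [] := uE x.
exists c; split=> //.
rewrite (eq_bigr (fun x => phi (cst (c x) * u x) / phi f ^+ s)).
  by rewrite -mulr_suml -rmorph_sum cu rmorph0 mul0r.
by move=> x _; have [_ ->] := uE x; rewrite rmorphM mulrA.
Qed.

Section Chain.
Variables (C : nat -> F -> Prop) (l : nat).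
Hypothesis CD : forall j, (j <= l)%N -> Dstable (C j).
Hypothesis Cstrict : forall j, (j < l)%N -> sstrict (C j) (C j.+1).

(** In a relation the earlier families lie in the smaller module, so independence modulo it kills
    the coefficients of the last family first; induction handles the others. *)
Lemma chain_frames l' : (l' <= l)%N ->
  exists (e : nat -> seq nat -> F) (s : nat), [/\
    forall j b, (j < l')%N -> size b = n -> C l' (e j b),
    forall j b, (j < l')%N -> size b = n -> bfilt (s + sumn b) (e j b) &
    forall T (c : nat -> seq nat -> k),
      \sum_(j < l') \sum_(b <- box n T) phi (cst (c j b)) * e j b = 0 ->
      forall j b, (j < l')%N -> b \in box n T -> c j b = 0].
Proof.
elim: l' => [|m IH] lm; first by exists (fun _ _ => 0), 0%N; split.
have [e [s [eC ef ei]]] := IH (ltnW lm).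
have [e' [s' [eC' ef' ei']]] :=
  Dstable_frame (CD (ltnW lm)) (CD lm) (Cstrict lm).
have [Cm _] := Cstrict lm.
exists (fun j => if j == m then e' else e j), (s + s')%N; split.
- move=> j b; case: eqP => [_ _|/eqP jm jm1 sb]; first exact: eC'.
  by apply/Cm/eC => //; rewrite ltn_neqAle jm -ltnS.
- move=> j b; case: eqP => [_ _|/eqP jm jm1] sb.
    by apply: bfiltW (ef' b sb); lia.
  by apply: bfiltW (ef j b _ sb); [lia | rewrite ltn_neqAle jm -ltnS].
move=> T c; rewrite big_ord_recr /= eqxx.
rewrite (eq_bigr (fun j : 'I_m => \sum_(b <- box n T) phi (cst (c j b)) * e j b));
  last by move=> j _; rewrite ltn_eqF.
set S := \sum_(j < m) _; set S' := \sum_(b <- _) _ => SS'.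
have CS : C m S.
  have [_ C0 Cadd Cmul _] := CD (ltnW lm).
  apply: (big_ind (C m)) => // j _; rewrite big_seq; apply: (big_ind (C m)) => // b.
  by rewrite mem_box => /andP[/eqP sb _]; apply/Cmul/eC.
have c'0 b : b \in box n T -> c m b = 0.
  move=> bT; apply: (fmorph_inj cst); rewrite rmorph0.
  apply: (ei' T (fun b => cst (c m b)) _ _ b bT); first by move=> b'; exists (c m b').
  have -> : \sum_(b <- box n T) phi (cst (c m b)) * e' b = phi (-1) * S.
    by rewrite rmorphN1 mulN1r; apply/eqP; rewrite -addr_eq0 addrC SS'.
  by apply: DstableM CS; apply: CD (ltnW lm).
have S'0 : S' = 0.
  by rewrite /S' big_seq big1 // => b bT; rewrite c'0 // !rmorph0 mul0r.
move=> j b; rewrite ltnS leq_eqVlt => /orP[/eqP -> |jm] bT; first exact: c'0.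
by apply: (ei T) jm bT; move: SS'; rewrite S'0 addr0.
Qed.

Lemma chain_dim : exists s, forall i, (l * 'C(n + i, n) <= 'C(n + d.+1 * (s + i), n))%N.
Proof.
have [e [s [_ ef ei]]] := chain_frames (leqnn l).
exists s => i; rewrite -size_simplex leqNgt; apply/negP; set S := simplex n i => lt_dim.
pose v (x : 'I_l * 'I_(size S)) := e x.1 (nth [::] S x.2).
have nthS (y : 'I_(size S)) : nth [::] S y \in S by rewrite mem_nth.
have fv x : bfilt (s + i) (v x).
  have := nthS x.2; rewrite mem_simplex => /andP[/eqP sb sumb].
  by apply: bfiltW (ef _ _ (ltn_ord x.1) sb); rewrite leq_add2l.
have [|c [[x cx] cv]] := bfilt_dependent fv; first by rewrite card_prod !card_ord.
(* The relation on pairs is re-indexed by the box; as [S] has no repetition, each sum has at most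
   one term. *)
pose c' (j : nat) b :=
  \sum_(y : 'I_l * 'I_(size S) | (y.1 == j :> nat) && (nth [::] S y.2 == b)) c y.
have c'0 : \sum_(j < l) \sum_(b <- box n i.+1) phi (cst (c' j b)) * e j b = 0.
  rewrite -[RHS]cv.
  under eq_bigr => j _ do under eq_bigr => b _ do
    rewrite /c' !rmorph_sum mulr_suml big_mkcond /=.
  under eq_bigr => j _ do rewrite exchange_big /=.
  rewrite exchange_big /=; apply: eq_bigr => y _.
  rewrite (bigD1 y.1) //= [X in _ + X]big1 ?addr0; last first.
    by move=> j jy; apply: big1 => b _; rewrite eq_sym val_eqE (negbTE jy).
  rewrite (bigD1_seq (nth [::] S y.2)) ?box_uniq //=; last first.
    by have := nthS y.2; rewrite mem_filter => /andP[].
  by rewrite !eqxx big1 ?addr0 // => b yb; rewrite eq_sym (negbTE yb) andbF.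
have := ei i.+1 c' c'0 x.1 (nth [::] S x.2) (ltn_ord _).
have := nthS x.2; rewrite mem_filter => /andP[_ xb] /(_ xb).
rewrite /c' (bigD1 x) ?eqxx //= big1 ?addr0; first by move/eqP; apply/negP.
move=> y /andP[/andP[/eqP y1 y2] yx]; case/eqP: yx.
apply/eqP; rewrite -pair_eqE /= -!val_eqE /= y1 eqxx /=.
by move: y2; rewrite nth_uniq ?simplex_uniq.
Qed.

Lemma chain_length : (l <= d.+1 ^ n)%N.
Proof. by have [s /binomial_growth_bound] := chain_dim. Qed.

End Chain.

Record Dsub (N : F -> Prop) : Prop := {
  Dsub_loc : forall q, N q -> exists g m, q = phi g / phi f ^+ m;
  Dsub0 : N 0;
  DsubD : forall q1 q2, N q1 -> N q2 -> N (q1 + q2);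
  DsubM : forall r q, N q -> N (phi r * q);
  Dsub_hasse : forall i t g m, N (phi g / phi f ^+ m) ->
    N (hasse_ratio i t g (f ^+ m)) }.

Lemma Dsub_stable N : Dsub N -> Dstable N.
Proof.
move=> [Nloc N0 ND NM NH]; split=> //.
- move=> q /Nloc[g [m ->]]; have [a ga] := deg_ex g.
  by exists (m + a)%N; apply: bfilt_exhaustive.
- move=> i t q Nq; have [g [m qE]] := Nloc q Nq.
  by rewrite qE -rmorphXn hasse_ratioE ?expf_neq0 //; apply: NH; rewrite -qE.
Qed.

Lemma Dsub_chain_length (C : nat -> F -> Prop) l :
  (forall j, (j <= l)%N -> Dsub (C j)) ->
  (forall j, (j < l)%N -> sstrict (C j) (C j.+1)) -> (l <= d.+1 ^ n)%N.
Proof. by move=> CD; apply: chain_length => j jl; apply/Dsub_stable/CD. Qed.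

End Localization.

(** * The polynomial ring *)

Section MultivariateTaylor.
Variables (k : fieldType) (n : nat).
Local Notation R := {mpoly k[n]}.

Lemma mpoly_rmorph_ext (S : nzRingType) (u v : {rmorphism R -> S}) :
  (forall c, u c%:MP = v c%:MP) -> (forall i, u 'X_i = v 'X_i) -> u =1 v.
Proof.
move=> uvC uvX p; rewrite [p]mpolyE !rmorph_sum; apply: eq_bigr => m _.
rewrite -mul_mpolyC !rmorphM uvC mpolyXE_id !rmorph_prod; congr (_ * _).
by apply: eq_bigr => i _; rewrite !rmorphXn uvX.
Qed.

(** Expansion with coefficients in R, where degrees can be bounded; [taylorE] carries it to the
    fraction field. *)
Definition mtaylor (i : 'I_n) : R -> {poly R} :=
  mmap (polyC \o @mpolyC n k) (fun j => ('X_j)%:P + (j == i)%:R * 'X).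

HB.instance Definition _ i := GRing.RMorphism.copy (mtaylor i)
  (mmap (polyC \o @mpolyC n k) (fun j => ('X_j)%:P + (j == i)%:R * 'X)).

Lemma mtaylorC i c : mtaylor i c%:MP = (c%:MP)%:P.
Proof. exact: mmapC. Qed.

Lemma mtaylorX i j : mtaylor i 'X_j = ('X_j)%:P + (j == i)%:R * 'X.
Proof. by rewrite /mtaylor mmapX mmap1U. Qed.

HB.instance Definition _ i := GRing.RMorphism.copy (@taylor k n i)
  (mmap (polyC \o (@FracField.tofrac R) \o @mpolyC n k)
     (fun j => (('X_j : R)%:F)%:P + (j == i)%:R * 'X)).

Lemma taylorE i (g : R) :
  taylor i g = map_poly (@FracField.tofrac R) (mtaylor i g).
Proof.
apply: (mpoly_rmorph_ext (u := @taylor k n i)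
  (v := map_poly (@FracField.tofrac R) \o mtaylor i)) => [c|j] /=.
  rewrite mtaylorC map_polyC /=.
  exact: (mmapC _ (polyC \o (@FracField.tofrac R) \o @mpolyC n k)).
rewrite mtaylorX rmorphD rmorphM /= map_polyX map_polyC rmorph_nat.
rewrite -[RHS](mmap1U (fun j => (('X_j : R)%:F)%:P + (j == i)%:R * 'X)).
exact: (mmapX _ (polyC \o (@FracField.tofrac R) \o @mpolyC n k)).
Qed.

Lemma mtaylor_coef0 i g : (mtaylor i g)`_0 = g.
Proof.
rewrite -horner_coef0.
apply: (mpoly_rmorph_ext (u := horner_eval 0 \o mtaylor i) (v := idfun))
  => [c|j] /=; rewrite /horner_eval.
  by rewrite mtaylorC hornerC.
by rewrite mtaylorX hornerD hornerC hornerM hornerX mulr0 addr0.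
Qed.

Lemma msizeM_leS (u v : R) a b :
  (msize u <= a.+1)%N -> (msize v <= b.+1)%N -> (msize (u * v) <= (a + b).+1)%N.
Proof.
have [->|u0] := eqVneq u 0; first by rewrite mul0r msize0.
have [->|v0] := eqVneq v 0; first by rewrite mulr0 msize0.
rewrite msizeM // => ua vb; rewrite -subn1 leq_subLR.
by apply: leq_trans (leq_add ua vb) _; rewrite addSn addnS add1n.
Qed.

Lemma msize_sum_leq (I : Type) (r : seq I) (P : pred I) (F : I -> R) a :
  (forall i, P i -> msize (F i) <= a)%N -> (msize (\sum_(i <- r | P i) F i) <= a)%N.
Proof.
move=> Fa; apply: (big_ind (fun u : R => msize u <= a)%N) => //.
- by rewrite msize0.
- by move=> u v ua va; apply: leq_trans (msizeD_le _ _) _; rewrite geq_max ua.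
Qed.

Let bounded a (P : {poly R}) := forall l, (msize P`_l <= a)%N.

Let boundedM a b P Q :
  bounded a.+1 P -> bounded b.+1 Q -> bounded (a + b).+1 (P * Q).
Proof.
by move=> Pa Qb l; rewrite coefM; apply: msize_sum_leq => j _; apply: msizeM_leS.
Qed.

(** On a monomial, each factor x_j becomes a polynomial in T with coefficients of degree at most 1,
    and degree bounds add up in products. *)
Lemma msize_mtaylor i (g : R) l : (msize (mtaylor i g)`_l <= msize g)%N.
Proof.
have bX (m : 'X_{1..n}) : bounded (mdeg m).+1 (mtaylor i 'X_[m]).
  rewrite mpolyXE_id rmorph_prod mdegE.
  apply: (big_ind2 (fun a P => bounded a.+1 P)) => [t|a P b Q|j _].
  - by rewrite coef1; case: t => [|t] /=; rewrite ?msize1 ?msize0.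
  - exact: boundedM.
  rewrite rmorphXn /= mtaylorX; elim: (m j) => [|c IH].
    by move=> t; rewrite expr0 coef1; case: t => [|t] /=; rewrite ?msize1 ?msize0.
  rewrite exprS; apply: (@boundedM 1 c) => // t.
  rewrite coefD coefC -polyC_natr coefCM coefX.
  apply: leq_trans (msizeD_le _ _) _; rewrite geq_max; apply/andP; split.
    by case: ifP; rewrite ?msize0 // msizeX mdeg1.
  by case: (j == i); case: (t == 1)%N; rewrite ?mulr1 ?mulr0 ?mul0r ?msize0 ?msize1.
rewrite {1}[g]mpolyE rmorph_sum coef_sum big_seq; apply: msize_sum_leq => m mg.
rewrite -mul_mpolyC rmorphM /= mtaylorC coefCM mul_mpolyC.
apply: leq_trans (msizeZ_le _ _) _; apply: leq_trans (bX m l) _.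
exact: msize_mdeg_lt.
Qed.

End MultivariateTaylor.

Lemma fraction_num_den (A : idomainType) (q : {fraction A}) :
  q = (\n_(repr q))%:F / (\d_(repr q))%:F.
Proof.
have d0 := denom_ratioP (repr q).
apply: (canRL (mulfK _)); first by rewrite tofrac_eq0.
rewrite -{1}[q]reprK; unlock FracField.tofrac.
rewrite -[LHS]FracField.pi_mul; apply/eqmodP; rewrite /= FracField.equivfE.
by rewrite /FracField.mulf !numden_Ratio ?oner_eq0 ?mulr1 // mulrC.
Qed.

Section PolynomialRing.
Variables (k : fieldType) (n : nat) (f : {mpoly k[n]}) (d : nat).
Local Notation R := {mpoly k[n]}.
Local Notation K := {fraction R}.
Hypotheses (f0 : f != 0) (fd : msize f = d.+1).

Lemma hasse_fracE (i : 'I_n) t (g b : R) :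
  hasse_frac i t g b =
  hasse_ratio (@FracField.tofrac R) (fun i => mtaylor i) i t g b.
Proof. by rewrite /hasse_frac !taylorE. Qed.

Lemma Dsubmod_chain_length (C : nat -> K -> Prop) l :
  (forall j, (j <= l)%N -> Dsubmod f (C j)) ->
  (forall j, (j < l)%N -> sstrict (C j) (C j.+1)) -> (l <= d.+1 ^ n)%N.
Proof.
move=> CD Cs.
have CD' j : (j <= l)%N -> Dsub (@FracField.tofrac R) (fun i => mtaylor i) f (C j).
  move=> jl; have [Cloc C0 CD' CM CH] := CD j jl; split=> //.
  by move=> i t g m Cg; rewrite -hasse_fracE; apply: CH.
(* [msize] is the degree plus one, and 0 at 0, hence the [a.+1] in [deg]. *)
move: CD' Cs; apply: (Dsub_chain_length
  (cst := @mpolyC n k) (phi := @FracField.tofrac R)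
  (num := fun q : K => \n_(repr q)) (den := fun q : K => \d_(repr q))
  (tay := fun i => mtaylor i) (X := fun i => 'X_i)
  (deg := fun (u : R) a => (msize u <= a.+1)%N) (f := f)).
- exact: tofrac_eq0.
- by move=> q; apply: denom_ratioP.
- exact: fraction_num_den.
- exact: mtaylor_coef0.
- exact: mtaylorC.
- exact: mtaylorX.
- by move=> a b u ab ua; apply: leq_trans ua _.
- by rewrite msize0.
- by rewrite msize1.
- by move=> i; rewrite msizeX mdeg1.
- by move=> u a; rewrite msizeN.
- by move=> u v a ua va; apply: leq_trans (msizeD_le _ _) _; rewrite geq_max ua.
- by move=> u v a b; apply: msizeM_leS.
- by move=> i g a t; apply: leq_trans (msize_mtaylor _ _ _).
- by move=> u; exists (msize u).
- move=> I u a ua /(mpoly_dependent ua)[c [c0 cu]]; exists c; split=> //.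
  by rewrite -[RHS]cu; apply: eq_bigr => x _; rewrite mul_mpolyC.
- exact: f0.
- by rewrite fd.
Qed.

Lemma Dsubmod0 : Dsubmod f (fun q : K => q = 0).
Proof.
split=> //.
- by move=> q ->; exists 0, 0%N; rewrite tofrac0 mul0r.
- by move=> q1 q2 -> ->; rewrite addr0.
- by move=> r q ->; rewrite mulr0.
move=> i t g m /eqP; rewrite mulf_eq0 invr_eq0 expf_eq0 !tofrac_eq0.
rewrite (negbTE f0) andbF orbF.
by move=> /eqP ->; rewrite hasse_fracE /hasse_ratio /ftaylor /= !rmorph0 mul0r coef0.
Qed.

End PolynomialRing.

Theorem theorem3p5 (k : fieldType) (n d : nat) (f : {mpoly k[n]}) :
  f != 0 -> msize f = d.+1 ->
  length_Rf_le f ((d.+1) ^ n)%N /\ length_H1f_le f ((d.+1) ^ n - 1)%N.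
Proof.
move=> f0 fd; split=> C l CD Cs; first exact: (Dsubmod_chain_length f0 fd CD Cs).
(* Prepending 0 adds a strict step, witnessed by 1 in R, so l + 1 obeys the bound. *)
pose C' j := if j is j'.+1 then C j' else fun q => q = 0.
have : (l.+1 <= d.+1 ^ n)%N.
  apply: (Dsubmod_chain_length f0 fd (C := C')) => [[|j] jl|[|j] jl] /=.
  - exact: Dsubmod0 f0.
  - by have [] := CD j jl.
  - have [[_ C0 _ _ _] CR] := CD 0%N (leq0n l).
    split=> [q ->//|]; exists 1; split; first by have := CR 1; rewrite tofrac1.
    by move/eqP; rewrite oner_eq0.
  - exact: Cs.
by rewrite leq_subRL ?expn_gt0 // add1n.
Qed.
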